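(* Let $n \ge 2$ and let $P_1,\dots,P_n$ be $n$ distinct points in Euclidean space $\mathbb{R}^3$ such that the maximum distance between any two of them is $a$, i.e. $a = \max_{1\le i<j\le n} \|P_i - P_j\|$. Then there exists a sphere, with some center $O \in \mathbb{R}^3$ and some radius $r > 0$ satisfying $r \le a\,\frac{\sqrt{6}}{4}$, that contains all the points $P_1,\dots,P_n$ in its interior or on its surface, i.e. $\|P_i - O\| \le r$ for all $1 \le i \le n$.
   Context: $\|\cdot\|$ denotes the Euclidean norm on $\mathbb{R}^3$. A point is in the interior or on the surface of the sphere with center $O$ and radius $r$ if its Euclidean distance to $O$ is at most $r$. *)

(* Defs.v *)
From mathcomp Require Import all_boot all_order all_algebra.
From mathcomp Require Import reals.

Set Implicit Arguments.
Unset Strict Implicit.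
Unset Printing Implicit Defensive.

Import Order.TTheory GRing.Theory Num.Theory.
Local Open Scope ring_scope.

(* Euclidean norm; the library norm `|u| on row vectors is the sup norm. *)
Definition enorm (R : realType) (d : nat) (u : 'rV[R]_d) : R :=
  Num.sqrt (\sum_(k < d) u 0 k ^+ 2).

(* Main.v *)
Require Import Defs.
From mathcomp Require Import all_boot all_order all_algebra.
From mathcomp Require Import reals.
From mathcomp Require Import boolp classical_sets topology normedtype derive.
From mathcomp Require Import ring lra.

Set Implicit Arguments.
Unset Strict Implicit.
Unset Printing Implicit Defensive.

Import Order.TTheory GRing.Theory Num.Theory.
Local Open Scope ring_scope.

(** The statement is Jung's theorem, proved here in every dimension d.  Put
weights l on the points and let O be their barycentre.  The centre is chosen by
maximising the variance r = sum of l_i |P_i - O|^2 over the simplex of weights;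
a maximum exists by compactness ([variance_max]).

Moving a small mass towards P_k changes the variance at first order by
|P_k - O|^2 - r, so maximality forces |P_k - O|^2 <= r for every k
([sqnorm_le_variance]): the ball with centre O and squared radius r contains
all the points.  Since r is also the weighted mean of the |P_k - O|^2, equality
holds wherever l_k is nonzero ([sqnorm_eq_variance]).

It remains to bound r by the squared diameter A ([variance_le]).  Write
v_i = P_i - O and g_ij for the scalar product of v_i and v_j.  For i and j of
positive weight |P_i - P_j|^2 = 2 r - 2 g_ij, so that g_ij lies between -c and
r, where c = A / 2 - r, and therefore (g_ij + c) (g_ij - r) <= 0.  Average this
over the weights l_i l_j.  The mean of g_ij is zero because O is the barycentre,
so the mean of g_ij^2 is at most c r.  That mean is also the squared Frobenius
norm of the matrix sum of l_i v_i^T v_i, whose trace is r, hence at least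
r^2 / d ([frobenius_ge]).  Thus r <= d c, that is 2 (d + 1) r <= d A.  In
dimension 3 this says r <= 3/8 A, and 3/8 is the square of sqrt 6 / 4. *)

(** * Euclidean scalar product *)

Section Dot.
Variables (R : realType) (d : nat).
Implicit Types u v w : 'rV[R]_d.

Definition dot u v : R := \sum_(k < d) u 0 k * v 0 k.

Definition sqnorm u : R := dot u u.

Lemma dotC u v : dot u v = dot v u.
Proof. by apply: eq_bigr => k _; rewrite mulrC. Qed.

Lemma dotDl u v w : dot (u + v) w = dot u w + dot v w.
Proof.
by rewrite -big_split /=; apply: eq_bigr => k _; rewrite mxE mulrDl.
Qed.

Lemma dotZl c u v : dot (c *: u) v = c * dot u v.
Proof. by rewrite mulr_sumr; apply: eq_bigr => k _; rewrite mxE mulrA. Qed.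

Lemma dotNl u v : dot (- u) v = - dot u v.
Proof. by rewrite -scaleN1r dotZl mulN1r. Qed.

Lemma dot_suml (n : nat) (F : 'I_n -> 'rV[R]_d) v :
  dot (\sum_i F i) v = \sum_i dot (F i) v.
Proof.
by rewrite exchange_big; apply: eq_bigr => k _; rewrite summxE mulr_suml.
Qed.

Lemma sqnormB u v : sqnorm (u - v) = sqnorm u - 2 * dot u v + sqnorm v.
Proof.
rewrite /sqnorm dotDl dotNl !(dotC _ (u - v)) !dotDl !dotNl (dotC v u); ring.
Qed.

Lemma sqnormZ c u : sqnorm (c *: u) = c ^+ 2 * sqnorm u.
Proof. by rewrite /sqnorm dotZl dotC dotZl mulrA. Qed.

Lemma sqnorm_ge0 u : 0 <= sqnorm u.
Proof. by apply: sumr_ge0 => k _; rewrite -expr2 sqr_ge0. Qed.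

Lemma sqnorm_eq0 u : sqnorm u = 0 -> u = 0.
Proof.
move=> u0; apply/rowP => k; rewrite mxE; apply/eqP.
have sq_ge0 (j : 'I_d) : true -> 0 <= u 0 j * u 0 j.
  by move=> _; rewrite -expr2 sqr_ge0.
by have /eqP := psumr_eq0P sq_ge0 u0 (i := k) isT; rewrite mulf_eq0 orbb.
Qed.

Lemma enormE u : enorm u = Num.sqrt (sqnorm u).
Proof. by congr Num.sqrt; apply: eq_bigr => k _; rewrite expr2. Qed.

Lemma enorm_le u r : 0 <= r -> (enorm u <= r) = (sqnorm u <= r ^+ 2).
Proof.
by move=> r0; rewrite enormE -{1}(ger0_norm r0) -sqrtr_sqr ler_sqrt ?sqr_ge0.
Qed.

End Dot.

(** Lagrange's identity: the difference of the two sides is half the sum of the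
squares (x k - x l)^2 over all pairs. *)
Lemma sqr_sum_le (R : realType) (d : nat) (x : 'I_d -> R) :
  (\sum_k x k) ^+ 2 <= d%:R * \sum_k x k ^+ 2.
Proof.
set s := \sum_k x k; set q := \sum_k _.
have : 0 <= \sum_k \sum_l (x k - x l) ^+ 2.
  by apply: sumr_ge0 => k _; apply: sumr_ge0 => l _; exact: sqr_ge0.
have -> : \sum_k \sum_l (x k - x l) ^+ 2 = 2 * (d%:R * q - s ^+ 2).
  have inner k : \sum_l (x k - x l) ^+ 2 = d%:R * x k ^+ 2 - 2 * s * x k + q.
    under eq_bigr => l _ do rewrite sqrrB.
    rewrite big_split sumrB /= -/q sumr_const card_ord sumrMnl -mulr_sumr -/s.
    by rewrite -(mulr_natl _ d) -(mulr_natl _ 2); ring.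
  under eq_bigr => k _ do rewrite inner.
  rewrite big_split sumrB /= sumr_const card_ord -!mulr_sumr -/s -/q.
  by rewrite -(mulr_natl _ d); ring.
by lra.
Qed.

(** * Variance of a weighted family of points *)

Section Weights.
Variables (R : realType) (d n : nat) (P : 'I_n -> 'rV[R]_d).
Implicit Type l : 'rV[R]_n.

Definition weights l : Prop := (forall i, 0 <= l 0 i) /\ \sum_i l 0 i = 1.

Definition bary l : 'rV[R]_d := \sum_i l 0 i *: P i.

Definition variance l : R := \sum_i l 0 i * sqnorm (P i - bary l).

Lemma dot_centered l u : weights l ->
  \sum_i l 0 i * dot (P i - bary l) u = 0.
Proof.
case=> _ l1.
under eq_bigr => i _ do rewrite dotDl dotNl mulrBr -dotZl.
by rewrite sumrB -dot_suml -mulr_suml l1 mul1r subrr.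
Qed.

(** The parallel axis theorem: the cross term vanishes because the barycentre is
the mean of the points. *)
Lemma huygens l c : weights l ->
  \sum_i l 0 i * sqnorm (P i - c) = variance l + sqnorm (bary l - c).
Proof.
move=> wl; have [_ l1] := wl.
transitivity (\sum_i (l 0 i * sqnorm (P i - bary l)
    - 2 * (l 0 i * dot (P i - bary l) (c - bary l))
    + l 0 i * sqnorm (bary l - c))).
  apply: eq_bigr => i _.
  have -> : P i - c = (P i - bary l) - (c - bary l).
    by rewrite opprB addrA subrK.
  rewrite sqnormB -(opprB c (bary l)) -(scaleN1r (c - _)) sqnormZ.
  by ring.
rewrite big_split sumrB /= -mulr_sumr dot_centered // -mulr_suml l1.
by rewrite mulr0 subr0 mul1r.
Qed.

(** The weighted mean of |P i - bary l|^2 is affine in the weights, and the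
barycentre moves by t (P k - bary l); [huygens] then subtracts the square of
this displacement. *)
Lemma variance_toward l k t : weights l -> 0 <= t <= 1 ->
  let l' := (1 - t) *: l + t *: delta_mx 0 k in
  weights l' /\
  variance l' = (1 - t) * (variance l + t * sqnorm (P k - bary l)).
Proof.
move=> wl /andP[t0 t1] l'; have [l0 l1] := wl.
have l'E (V : lmodType R) (g : 'I_n -> V) :
    \sum_i l' 0 i *: g i = (1 - t) *: (\sum_i l 0 i *: g i) + t *: g k.
  have l'i i : l' 0 i = (1 - t) * l 0 i + t * (i == k)%:R.
    by rewrite !mxE.
  under eq_bigr => i _ do rewrite l'i scalerDl -!scalerA.
  rewrite big_split /= -!scaler_sumr [X in _ + t *: X](bigD1 k) //=.
  rewrite eqxx scale1r.
  by rewrite [X in g k + X]big1 ?addr0 // => i /negPf->; rewrite scale0r.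
have wl' : weights l'.
  split=> [i|]; first by rewrite !mxE; apply: addr_ge0;
    apply: mulr_ge0; rewrite ?subr_ge0 ?ler0n.
  have := l'E R^o (fun=> 1).
  under eq_bigr => i _ do rewrite [_ *: _]mulr1.
  move=> ->; rewrite (eq_bigr (l 0)) => [|i _]; last by rewrite [LHS]mulr1.
  by rewrite l1 /GRing.scale /= !mulr1 subrK.
split=> //.
have := huygens (bary l) wl'.
have := l'E R^o (fun i => sqnorm (P i - bary l)).
rewrite /GRing.scale /= -/(variance l) => -> huy.
have sqb : sqnorm (bary l' - bary l) = t ^+ 2 * sqnorm (P k - bary l).
  rewrite -sqnormZ; congr sqnorm; rewrite {1}/bary l'E -/(bary l).
  by rewrite scalerBl scale1r scalerBr -(addrA (bary l)) (addrC (bary l))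
       addrK addrC.
by move: huy; rewrite sqb => ?; lra.
Qed.

(** First-order optimality in the direction of the vertex k of the simplex. *)
Lemma sqnorm_le_variance l k : weights l ->
  (forall l', weights l' -> variance l' <= variance l) ->
  sqnorm (P k - bary l) <= variance l.
Proof.
move=> wl lmax; set D := sqnorm _; set v := variance l.
rewrite leNgt; apply/negP => vD.
have v0 : 0 <= v.
  by apply: sumr_ge0 => i _; rewrite mulr_ge0 ?sqnorm_ge0; case: wl.
have D0 : 0 < D by exact: le_lt_trans vD.
(* By [variance_toward] the gain is t (D - v - t D); this t maximises it. *)
pose t := (D - v) / (2 * D).
have tD : t * D = (D - v) / 2 by rewrite /t; field; rewrite gt_eqF.
have t0 : 0 < t by rewrite divr_gt0 ?subr_gt0 // mulr_gt0.
have t1 : t <= 1 by rewrite ler_pdivrMr ?mulr_gt0 //; lra.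
have t01 : 0 <= t <= 1 by rewrite (ltW t0).
have [wl' vl'] := variance_toward k wl t01.
have := lmax _ wl'; rewrite vl' -/D -/v => le_v.
nra.
Qed.

(** Complementary slackness: the nonnegative terms
l i (variance l - |P i - bary l|^2) add up to zero. *)
Lemma sqnorm_eq_variance l : weights l ->
  (forall k, sqnorm (P k - bary l) <= variance l) ->
  forall k, l 0 k * sqnorm (P k - bary l) = l 0 k * variance l.
Proof.
move=> [l0 l1] le_v k; apply/eqP; rewrite eq_sym -subr_eq0 -mulrBr; apply/eqP.
apply: (psumr_eq0P (P := xpredT)
  (F := fun i => l 0 i * (variance l - sqnorm (P i - bary l)))) => //.
- by move=> i _; rewrite mulr_ge0 // subr_ge0.
- under eq_bigr => i _ do rewrite mulrBr.
  by rewrite sumrB -mulr_suml l1 mul1r subrr.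
Qed.

(** With M the sum of the l i (v i)^T (v i), the left side is (tr M)^2 and the
double sum is the squared Frobenius norm of M, which dominates the sum of the
squares of the diagonal entries; Cauchy-Schwarz on the diagonal gives the factor
d. *)
Lemma frobenius_ge l (v : 'I_n -> 'rV[R]_d) :
  (\sum_i l 0 i * sqnorm (v i)) ^+ 2 <=
  d%:R * \sum_i \sum_j l 0 i * l 0 j * dot (v i) (v j) ^+ 2.
Proof.
pose M p q := \sum_i l 0 i * (v i 0 p * v i 0 q).
have -> : \sum_i l 0 i * sqnorm (v i) = \sum_p M p p.
  rewrite exchange_big; apply: eq_bigr => i _.
  by rewrite mulr_sumr.
have -> : \sum_i \sum_j l 0 i * l 0 j * dot (v i) (v j) ^+ 2 =
    \sum_p \sum_q M p q ^+ 2.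
  have lhsE i j : l 0 i * l 0 j * dot (v i) (v j) ^+ 2 = \sum_p \sum_q
      (l 0 i * (v i 0 p * v i 0 q)) * (l 0 j * (v j 0 p * v j 0 q)).
    rewrite expr2 mulr_suml mulr_sumr; apply: eq_bigr => p _.
    by rewrite !mulr_sumr; apply: eq_bigr => q _; ring.
  under eq_bigr => i _ do under eq_bigr => j _ do rewrite lhsE.
  under eq_bigr => i _ do rewrite exchange_big.
  rewrite exchange_big; apply: eq_bigr => p _ /=.
  under eq_bigr => i _ do rewrite exchange_big.
  rewrite exchange_big; apply: eq_bigr => q _ /=.
  rewrite expr2 mulr_suml; apply: eq_bigr => i _.
  by rewrite mulr_sumr.
apply: le_trans (sqr_sum_le _) _; rewrite ler_wpM2l ?ler0n //.
apply: ler_sum => p _; rewrite (bigD1 p) //= lerDl.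
by apply: sumr_ge0 => q _; exact: sqr_ge0.
Qed.

(** In the product weights l i l j the scalar products g i j have mean zero and
second moment at least variance^2 / d, and where the weight is nonzero their
values lie in [-c, variance] with c = A / 2 - variance.  The three together give
variance <= d c, which is the conclusion. *)
Lemma variance_le l A : weights l ->
  (forall k, sqnorm (P k - bary l) <= variance l) ->
  (forall i j, sqnorm (P i - P j) <= A) ->
  2 * d.+1%:R * variance l <= d%:R * A.
Proof.
move=> wl le_v leA; have [l0 l1] := wl.
set r := variance l in le_v *; set c := A / 2 - r.
pose v i := P i - bary l; pose g i j := dot (v i) (v j).
have l_sq k : l 0 k * sqnorm (v k) = l 0 k * r by exact: sqnorm_eq_variance.
have r0 : 0 <= r by apply: sumr_ge0 => i _; rewrite mulr_ge0 ?sqnorm_ge0.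
have r_def : r = \sum_i l 0 i * sqnorm (v i) by [].
clearbody r.
have gB i j : sqnorm (P i - P j) = sqnorm (v i) - 2 * g i j + sqnorm (v j).
  by rewrite -sqnormB; congr sqnorm; rewrite /v opprB addrA subrK.
have pair_le i j : l 0 i * l 0 j * ((g i j + c) * (g i j - r)) <= 0.
  have [li0|li0] := eqVneq (l 0 i) 0; first by rewrite li0 !mul0r.
  have [lj0|lj0] := eqVneq (l 0 j) 0; first by rewrite lj0 mulr0 !mul0r.
  have vi : sqnorm (v i) = r by exact: (mulfI li0 (l_sq i)).
  have vj : sqnorm (v j) = r by exact: (mulfI lj0 (l_sq j)).
  apply: mulr_ge0_le0; first exact: mulr_ge0.
  have := leA i j; have := sqnorm_ge0 (P i - P j); rewrite gB vi vj => ge0 leA'.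
  by apply: mulr_ge0_le0; rewrite /c; lra.
have sum_g : \sum_i \sum_j l 0 i * l 0 j * g i j = 0.
  rewrite big1 // => i _.
  under eq_bigr => j _ do rewrite -mulrA /g dotC.
  by rewrite -mulr_sumr dot_centered ?mulr0.
have sum_l : \sum_i \sum_j l 0 i * l 0 j = 1.
  by under eq_bigr => i _ do rewrite -mulr_sumr l1 mulr1.
set S := \sum_i \sum_j l 0 i * l 0 j * g i j ^+ 2.
have S_le : S <= c * r.
  have : \sum_i \sum_j l 0 i * l 0 j * ((g i j + c) * (g i j - r)) <= 0.
    by apply: sumr_le0 => i _; apply: sumr_le0 => j _.
  have -> : \sum_i \sum_j l 0 i * l 0 j * ((g i j + c) * (g i j - r)) =
      S + (c - r) * (\sum_i \sum_j l 0 i * l 0 j * g i j)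
      - (c * r) * (\sum_i \sum_j l 0 i * l 0 j).
    rewrite !mulr_sumr -big_split -sumrB; apply: eq_bigr => i _ /=.
    rewrite !mulr_sumr -big_split -sumrB; apply: eq_bigr => j _ /=.
    ring.
  by rewrite sum_g sum_l; lra.
have r2_le : r ^+ 2 <= d%:R * S by rewrite r_def; exact: frobenius_ge.
have d0 : 0 <= d%:R :> R by exact: ler0n.
have rc : r * r <= r * (d%:R * c) by nra.
(* Dividing rc by r; for r = 0 the bound reduces to 0 <= A. *)
rewrite -natr1.
have [r_eq0|r_neq0] := eqVneq r 0; last first.
  have r_gt0 : 0 < r by rewrite lt0r r_neq0.
  by move: rc; rewrite ler_pM2l // /c; lra.
rewrite r_eq0 mulr0.
have [i _|no_pt] := pickP 'I_n; last first.
  by move: l1; rewrite big_pred0 // => /esym/eqP; rewrite oner_eq0.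
exact: mulr_ge0 (le_trans (sqnorm_ge0 _) (leA i i)).
Qed.

End Weights.

(** * Optimal weights *)

Section Maximiser.
Variables (R : realType) (d n : nat) (P : 'I_n -> 'rV[R]_d).
Local Open Scope classical_set_scope.
Import numFieldNormedType.Exports.

Lemma sum_continuous (T : topologicalType) m (f : 'I_m -> T -> R) :
  (forall i, continuous (f i)) -> continuous (fun x => \sum_i f i x).
Proof.
move=> fc; apply: continuous_big; first exact: add_continuous.
by move=> i _; exact: fc.
Qed.

Lemma variance_continuous : continuous (variance P).
Proof.
have coordc i k : continuous (fun l : 'rV[R]_n => (P i - bary P l) 0 k).
  rewrite (_ : (fun _ => _) = fun l : 'rV[R]_n =>
      P i 0 k - \sum_j l 0 j * P j 0 k); last first.
    apply/funext => l; rewrite 2!mxE summxE; congr (_ - _).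
    by apply: eq_bigr => j _; rewrite mxE.
  move=> y; apply: (@continuousB _ _ _ (fun=> P i 0 k)).
    exact: cst_continuous.
  apply: sum_continuous => j z.
  apply: (@continuousM _ _ (fun l : 'rV[R]_n => l 0 j)).
    exact: coord_continuous.
  exact: cst_continuous.
apply: sum_continuous => i x.
apply: (@continuousM _ _ (fun l : 'rV[R]_n => l 0 i)).
  exact: coord_continuous.
apply: sum_continuous => k y.
by apply: (@continuousM _ _ (fun l : 'rV[R]_n => (P i - bary P l) 0 k));
  exact: coordc.
Qed.

Lemma variance_max : (0 < n)%N ->
  exists2 l, weights l & forall l', weights l' -> variance P l' <= variance P l.
Proof.
move=> n_gt0; pose A : set 'rV[R]_n := [set l | weights l].
have A0 : A !=set0.
  pose k := Ordinal n_gt0.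
  exists (delta_mx 0 k); split=> [i|]; first by rewrite mxE ler0n.
  rewrite (bigD1 k) //= big1 ?mxE ?eqxx ?addr0 // => i /negPf.
  by rewrite mxE => ->.
have cA : compact A.
  pose unit_box := [set l : 'rV[R]_n | forall i, `[0, 1]%classic (l ord0 i)].
  have box : compact unit_box.
    apply: (@rV_compact R n (fun=> `[0, 1]%classic)) => i.
    exact: segment_compact.
  rewrite (_ : A = unit_box `&`
      (fun l : 'rV[R]_n => \sum_i l 0 i) @^-1` [set x | x = 1]).
    apply: compact_closedI => //; apply: preimage_closed; last exact: closed_eq.
    by move=> x _; apply: sum_continuous => i; exact: coord_continuous.
  apply/seteqP; split=> l /=.
    move=> [l0 l1]; split=> // i; rewrite /= in_itv /= l0 -l1 (bigD1 i) //=.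
    by rewrite lerDl sumr_ge0.
  move=> [l01 l1]; split=> // i.
  by have := l01 i; rewrite /= in_itv /= => /andP[].
have [l] := EVT_max_rV A0 cA (continuous_subspaceT variance_continuous).
by rewrite inE => wl lmax; exists l => // l' wl'; apply: lmax; rewrite inE.
Qed.

End Maximiser.

(** * Jung's theorem *)

Theorem jung_sqnorm (R : realType) (d n : nat) (P : 'I_n -> 'rV[R]_d) (A : R) :
  (0 < n)%N -> (forall i j, sqnorm (P i - P j) <= A) ->
  exists O, forall i, 2 * d.+1%:R * sqnorm (P i - O) <= d%:R * A.
Proof.
move=> n_gt0 leA; have [l wl lmax] := variance_max P n_gt0.
have le_v k : sqnorm (P k - bary P l) <= variance P l.
  exact: sqnorm_le_variance.
exists (bary P l) => i; apply: le_trans (variance_le wl le_v leA).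
by rewrite ler_wpM2l // mulr_ge0 ?ler0n.
Qed.

Theorem mainTheorem1 (R : realType) (n : nat) (hn : (2 <= n)%N)
    (P : 'I_n -> 'rV[R]_3) (hP : injective P) (a : R)
    (ha_ub : forall i j : 'I_n, (i < j)%N -> enorm (P i - P j) <= a)
    (ha_att : exists i j : 'I_n, (i < j)%N /\ enorm (P i - P j) = a) :
  exists (O : 'rV[R]_3) (r : R),
    [/\ 0 < r, r <= a * (Num.sqrt 6 / 4)
      & forall i : 'I_n, enorm (P i - O) <= r].
Proof.
have a_gt0 : 0 < a.
  have [i [j [lt_ij <-]]] := ha_att.
  rewrite enormE sqrtr_gt0 lt0r sqnorm_ge0 andbT.
  apply/eqP => /sqnorm_eq0/subr0_eq/hP eq_ij.
  by rewrite eq_ij ltnn in lt_ij.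
have le_a i j : sqnorm (P i - P j) <= a ^+ 2.
  rewrite -enorm_le ?(ltW a_gt0) //.
  have [lt_ij|lt_ji|/val_inj ->] := ltngtP i j; first exact: ha_ub.
    by rewrite -opprB enormE -scaleN1r sqnormZ sqrrN expr1n mul1r -enormE ha_ub.
  by rewrite subrr enormE -(scale0r 0) sqnormZ expr0n mul0r sqrtr0 ltW.
have [O le_O] := jung_sqnorm (ltnW hn) le_a.
have r_gt0 : 0 < a * (Num.sqrt 6 / 4) :> R.
  by rewrite mulr_gt0 ?divr_gt0 ?sqrtr_gt0.
exists O, (a * (Num.sqrt 6 / 4)); split=> // i.
rewrite enorm_le ?(ltW r_gt0) // !exprMn sqr_sqrtr //.
by have := le_O i; lra.
Qed.
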